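(* Let $n\ge1$, and for $k=1,\ldots,n$ let the set of values of the input $\lambda^k$ be the finite set $\Lambda^k=\{1,\ldots,m_k\}$ and the set of values of the random output $A^k$ be the finite set $\{1,\ldots,v_k\}$. Let $\Phi\subset\Lambda^1\times\ldots\times\Lambda^n$ be a nonempty set of allowable treatments, and for each $\phi\in\Phi$ let $(A^1_\phi,\ldots,A^n_\phi)$ be jointly distributed random variables. Let $M$ be the Boolean matrix and $P$ the vector of observed probabilities associated with these data, as defined in the context. Then $$(A^{1},\ldots,A^{n})\looparrowleft(\lambda^{1},\ldots,\lambda^{n})$$ holds if and only if the system of linear equations $$MQ=P$$ has a solution $Q\geq 0$ (meaning that all elements of the column vector $Q$ are non-negative).
   Context: Setting. For each $k$, all $A^k_\phi$ ($\phi\in\Phi$) take values in $\{1,\ldots,v_k\}$ (with the power set as sigma-algebra). For different $\phi$ the vectors $(A^1_\phi,\ldots,A^n_\phi)$ are stochastically unrelated, so the data consist of one probability distribution on $\{1,\ldots,v_1\}\times\ldots\times\{1,\ldots,v_n\}$ for each $\phi\in\Phi$. The symbol $\sim$ means ''has the same distribution as''. Definition (selective influences): $(A^{1},\ldots,A^{n})\looparrowleft(\lambda^{1},\ldots,\lambda^{n})$ means that there exist a random variable $R$ (with values in an arbitrary measurable space) and functions $f_{1},\ldots,f_{n}$, with each $f_k(\lambda,\cdot)$ measurable, such that $(A_{\phi}^{1},\ldots,A_{\phi}^{n})\sim(f_{1}(\lambda^{1},R),\ldots,f_{n}(\lambda^{n},R))$ for every $\phi=(\lambda^{1},\ldots,\lambda^{n})\in\Phi$.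 Definition of $M$ and $P$: - The rows of $M$, and the entries of the column vector $P$ in the same order, are labeled by pairs $I=(a_1,\ldots,a_n;\,l_1,\ldots,l_n)$ with $a_k\in\{1,\ldots,v_k\}$ (output values) and $(l_1,\ldots,l_n)\in\Phi$ (an allowable treatment). - The columns of $M$, and the entries of the column vector $Q$ in the same order, are labeled by vectors $J=(h^1_1,\ldots,h^1_{m_1},\ldots,h^n_1,\ldots,h^n_{m_n})$ with $h^k_i\in\{1,\ldots,v_k\}$ for $i=1,\ldots,m_k$, $k=1,\ldots,n$. - The entry of $M$ in cell $(I,J)$ is $1$ if $(h^1_{l_1},\ldots,h^n_{l_n})=(a_1,\ldots,a_n)$, and $0$ otherwise. - The entry of $P$ labeled by $I$ is $\Pr(A^1_\phi=a_1,\ldots,A^n_\phi=a_n)$ with $\phi=(l_1,\ldots,l_n)$. *)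

(* Defs.v *)
From HB Require Import structures.
From mathcomp Require Import all_boot all_order all_algebra.
From mathcomp Require Import all_classical all_reals all_analysis.

Set Implicit Arguments.
Unset Strict Implicit.
Unset Printing Implicit Defensive.

Import Order.TTheory GRing.Theory Num.Theory.

Local Open Scope classical_set_scope.
Local Open Scope ring_scope.

(* A set {1,...,w} is represented by 'I_w, and {1,...,w_1} x ... x {1,...,w_n} *)
(* by [prod_ord w].                                                           *)
Definition prod_ord (n : nat) (w : 'I_n -> nat) : finType :=
  {dffun forall k : 'I_n, 'I_(w k)}.

Definition allowable (n : nat) (m : 'I_n -> nat) (Phi : {set prod_ord m}) :
  finType := {phi : prod_ord m | phi \in Phi}.

(* Measurability with respect to the power set of the codomain. This is       *)
(* [measurable_fun setT] for the discrete sigma-algebra, written out because  *)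
(* a measurableType has to be pointed, which 'I_w is not for a variable w.    *)
Definition powerset_measurable d (T : measurableType d) (V : Type)
    (X : T -> V) : Prop :=
  forall B : set V, measurable (X @^-1` B).

(* X ~ Y, for V with its power set; on a finite product of finite sets the    *)
(* product of the power-set sigma-algebras is again the power set.            *)
Definition same_distribution (R : realType) (V : Type)
    d1 (T1 : measurableType d1) (P1 : probability T1 R) (X : T1 -> V)
    d2 (T2 : measurableType d2) (P2 : probability T2 R) (Y : T2 -> V) : Prop :=
  forall B : set V, P1 (X @^-1` B) = P2 (Y @^-1` B).

(* The vectors (A^1_phi, ..., A^n_phi) for different phi are stochastically   *)
(* unrelated: each one lives on a probability space of its own.               *)
Definition selective_influences (R : realType) (n : nat) (m v : 'I_n -> nat)
    (Phi : {set prod_ord m})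
    (d : allowable Phi -> measure_display)
    (T : forall phi, measurableType (d phi))
    (Pr : forall phi, probability (T phi) R)
    (A : forall (k : 'I_n) (phi : allowable Phi), T phi -> 'I_(v k)) : Prop :=
  exists (dO : measure_display) (Omega : measurableType dO)
         (mu : probability Omega R)
         (dS : measure_display) (S : measurableType dS)
         (X : {RV mu >-> S})
         (f : forall k : 'I_n, 'I_(m k) -> S -> 'I_(v k)),
    (forall k l, powerset_measurable (f k l)) /\
    (forall phi : allowable Phi,
       same_distribution
         (Pr phi) (fun t => finfun (fun k => A k phi t) : prod_ord v)
         mu (fun w => finfun (fun k => f k (val phi k) (X w)) : prod_ord v)).

Definition row_label (n : nat) (m v : 'I_n -> nat) (Phi : {set prod_ord m}) :
  finType := (prod_ord v * allowable Phi)%type.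

(* h (Tagged _ i), with i : 'I_(m k), is the entry h^k_i.                      *)
Definition column_label (n : nat) (m v : 'I_n -> nat) : finType :=
  {dffun forall ki : {k : 'I_n & 'I_(m k)}, 'I_(v (tag ki))}.

Definition column_entry (n : nat) (m v : 'I_n -> nat) (h : column_label m v)
    (k : 'I_n) (i : 'I_(m k)) : 'I_(v k) :=
  h (Tagged (fun k : 'I_n => 'I_(m k)) i).

(* Rows and columns are enumerated by [enum_val].                             *)
Definition incidence_matrix (R : realType) (n : nat) (m v : 'I_n -> nat)
    (Phi : {set prod_ord m}) :
    'M[R]_(#|row_label v Phi|, #|column_label m v|) :=
  \matrix_(i, j)
    let a : prod_ord v := (enum_val i).1 in
    let phi : prod_ord m := val (enum_val i).2 in
    let h : column_label m v := enum_val j in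
    [forall k : 'I_n, column_entry h (phi k) == a k]%:R.

Definition observed_probabilities (R : realType) (n : nat) (m v : 'I_n -> nat)
    (Phi : {set prod_ord m})
    (d : allowable Phi -> measure_display)
    (T : forall phi, measurableType (d phi))
    (Pr : forall phi, probability (T phi) R)
    (A : forall (k : 'I_n) (phi : allowable Phi), T phi -> 'I_(v k)) :
    'cV[R]_#|row_label v Phi| :=
  \col_i
    let a : prod_ord v := (enum_val i).1 in
    let phi : allowable Phi := (enum_val i).2 in
    fine (Pr phi [set t | forall k : 'I_n, A k phi t = a k]).

(* Main.v *)
(* A pair (R, f) enters only through the joint law of all the potential       *)
(* outputs f_k(i, R), a random element h of the finite set of column labels;  *)
(* Q is that law. Conversely, a solution Q >= 0 has total mass 1, because the *)
(* entries of P for one fixed treatment sum to 1, so a random h with law Q    *)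
(* can serve as R, with f_k(i, h) = h^k_i.                                    *)

Require Import Defs.
From HB Require Import structures.
From mathcomp Require Import all_boot all_order all_algebra.
From mathcomp Require Import all_classical all_reals all_analysis.

Set Implicit Arguments.
Unset Strict Implicit.
Unset Printing Implicit Defensive.

Import Order.TTheory GRing.Theory Num.Theory.

Local Open Scope ring_scope.

(** For a treatment [phi], the row of the matrix labeled [(a, phi)] is the indicator of the fiber of
    [treatment_outputs phi] over [a]. Hence MQ = P says that, for every allowable [phi], the image
    of Q under [treatment_outputs phi] is the law of the outputs observed at [phi]
    ([linear_systemP]). Since all value sets are finite, point masses determine these laws
    ([probability_preimage_fin]). So Q is exactly a joint law of all potential outputs with the
    observed laws as marginals: a pair (R, f) yields one by push-forward, and a solution Q is
    realized as an actual random variable through [finite_probability_nat]. *)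

Section finite_valued.
Context (R : realType) d (T : measurableType d) (V : finType).
Implicit Types X : T -> V.

Lemma powerset_measurable_fin X :
  (forall x, measurable (X @^-1` [set x])%classic) -> powerset_measurable X.
Proof.
move=> mX B; have -> : (X @^-1` B = \bigcup_(x in B) X @^-1` [set x])%classic.
  by apply/seteqP; split=> [t Bt|t [x Bx /= ->]]//; exists (X t).
by apply: fin_bigcup_measurable => //; apply: finite_finset.
Qed.

Lemma probability_preimage_fin (P : probability T R) X (B : set V) :
  powerset_measurable X ->
  P (X @^-1` B)%classic = (\sum_(x in B) P (X @^-1` [set x])%classic)%E.
Proof.
move=> mX; have -> : (X @^-1` B = \bigcup_(x in B) X @^-1` [set x])%classic.
  by apply/seteqP; split=> [t Bt|t [x Bx /= ->]]//; exists (X t).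
rewrite measure_fin_bigcup//; first 1 last.
- exact: finite_finset.
- by move=> x y _ _ [t [/= <- <-]].
rewrite fsbig_mkcond (fsbigE (index_enum V)) ?index_enum_uniq//; first 1 last.
  by move=> x _; rewrite mem_index_enum.
by rewrite [RHS]big_mkcond; apply: eq_big => // x; rewrite in_setT.
Qed.

End finite_valued.

Lemma powerset_measurable_dffun d (T : measurableType d) (I : finType)
    (V : I -> finType) (X : forall i, T -> V i) :
  (forall i, powerset_measurable (X i)) ->
  powerset_measurable (fun t => finfun (fun i => X i t) : {dffun forall i, V i}).
Proof.
move=> mX; apply: powerset_measurable_fin => a.
have -> : ((fun t => finfun (fun i => X i t) : {dffun forall i, V i}) @^-1`
    [set a] = \bigcap_(i in setT) X i @^-1` [set a i])%classic.
  apply/seteqP; split=> [t /= <- i _|t /= Xa]; first by rewrite /= ffunE.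
  by apply/ffunP => i; rewrite ffunE; apply: Xa.
by apply: fin_bigcap_measurable => [|i _]; [exact: finite_finset|exact: mX].
Qed.

(** The measure is the mixture of Dirac masses at 0, ..., N-1 with weights [q]. Living on [nat]
    rather than on the labels, it has a discrete, pointed sample space at hand. *)
Lemma finite_probability_nat (R : realType) N (q : 'I_N -> R) :
  (forall j, 0 <= q j) -> \sum_j q j = 1 ->
  exists mu : probability nat R,
    forall B : set nat, mu B = (\sum_(j < N | (j : nat) \in B) q j)%:E.
Proof.
move=> q_ge0 q_sum1.
(* [mscale] needs a nonnegative weight at every natural number: [q] is extended by 0, and the
   absolute value changes nothing by [q_ge0]. *)
pose c (j : nat) : {nonneg R} :=
  NngNum (normr_ge0 (oapp q 0 (insub j : option 'I_N))).
pose nu := msum (fun j => mscale (c j) (\d_j : {measure set nat -> \bar R})) N.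
have nuE (B : set nat) : nu B = (\sum_(j < N | (j : nat) \in B) q j)%:E.
  rewrite /nu /msum -sumEFin [RHS]big_mkcond; apply: eq_bigr => j _ /=.
  rewrite /mscale /= valK /= ger0_norm// diracE.
  by case: ifP => _; rewrite ?mule1 ?mule0.
have nuT : nu setT = 1%E.
  rewrite nuE (eq_bigl predT) ?q_sum1// => j; exact: in_setT.
pose mu : probability nat R := HB.pack nu (Measure_isProbability.Build _ _ _ nu nuT).
by exists mu.
Qed.

Definition treatment_outputs (n : nat) (m v : 'I_n -> nat)
    (phi : prod_ord m) (h : column_label m v) : prod_ord v :=
  [ffun k => column_entry h (phi k)].

Section linear_system.
Context (R : realType) (n : nat) (m v : 'I_n -> nat) (Phi : {set prod_ord m}).

Lemma incidence_mulE (Q : 'cV[R]_#|column_label m v|) (a : prod_ord v)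
    (phi : allowable Phi) :
  (incidence_matrix R v Phi *m Q) (enum_rank ((a, phi) : row_label v Phi)) 0 =
  \sum_(j | treatment_outputs (val phi) (enum_val j) == a) Q j 0.
Proof.
rewrite mxE [RHS]big_mkcond; apply: eq_bigr => j _.
rewrite mxE enum_rankK /=.
have -> : [forall k, column_entry (enum_val j) (val phi k) == a k] =
    (treatment_outputs (val phi) (enum_val j) == a).
  apply/forallP/eqP => [ha|<- k]; last by rewrite ffunE.
  by apply/ffunP => k; rewrite ffunE; apply/eqP/ha.
by case: eqP => _; rewrite ?mul1r ?mul0r.
Qed.

Lemma observed_probabilitiesE
    (d : allowable Phi -> measure_display)
    (T : forall phi, measurableType (d phi))
    (Pr : forall phi, probability (T phi) R)
    (A : forall (k : 'I_n) (phi : allowable Phi), T phi -> 'I_(v k)) :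
  (forall k phi, powerset_measurable (A k phi)) ->
  forall (a : prod_ord v) (phi : allowable Phi),
  (observed_probabilities Pr A (enum_rank ((a, phi) : row_label v Phi)) 0)%:E =
  Pr phi ((fun t => [ffun k => A k phi t] : prod_ord v) @^-1` [set a])%classic.
Proof.
move=> mA a phi; rewrite mxE enum_rankK /= fineK.
  congr (Pr phi _); apply/seteqP; split=> [t /= ta|t /= ta k].
    by apply/ffunP => k; rewrite ffunE.
  by rewrite -ta ffunE.
apply: fin_num_measure; rewrite (_ : [set t | _]%classic =
  \bigcap_(k in setT) A k phi @^-1` [set a k])%classic.
  by apply: fin_bigcap_measurable => [|k _]; [exact: finite_finset|exact: mA].
by apply/seteqP; split=> [t /= ta k _|t /= ta k]; [exact: ta|exact: (ta k)].
Qed.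

Lemma linear_systemP
    (d : allowable Phi -> measure_display)
    (T : forall phi, measurableType (d phi))
    (Pr : forall phi, probability (T phi) R)
    (A : forall (k : 'I_n) (phi : allowable Phi), T phi -> 'I_(v k)) :
  (forall k phi, powerset_measurable (A k phi)) ->
  forall Q : 'cV[R]_#|column_label m v|,
  incidence_matrix R v Phi *m Q = observed_probabilities Pr A <->
  forall (a : prod_ord v) (phi : allowable Phi),
    Pr phi ((fun t => [ffun k => A k phi t] : prod_ord v) @^-1` [set a])%classic =
    (\sum_(j | treatment_outputs (val phi) (enum_val j) == a) Q j 0)%:E.
Proof.
move=> mA Q; split=> [MQ a phi|PQ].
  by rewrite -(observed_probabilitiesE _ mA) -MQ incidence_mulE.
apply/colP => i; rewrite -(enum_valK i); case: (enum_val i) => a phi.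
by apply/EFin_inj; rewrite (observed_probabilitiesE _ mA) PQ incidence_mulE.
Qed.

End linear_system.

Theorem theorem1p8 (R : realType) (n : nat) (n_ge1 : (1 <= n)%N)
    (m v : 'I_n -> nat)
    (Phi : {set prod_ord m}) (Phi_neq0 : Phi != finset.set0)
    (d : allowable Phi -> measure_display)
    (T : forall phi : allowable Phi, measurableType (d phi))
    (Pr : forall phi : allowable Phi, probability (T phi) R)
    (A : forall (k : 'I_n) (phi : allowable Phi), T phi -> 'I_(v k))
    (A_measurable : forall (k : 'I_n) (phi : allowable Phi),
       powerset_measurable (A k phi)) :
  selective_influences Pr A <->
  exists Q : 'cV[R]_#|column_label m v|,
    incidence_matrix R v Phi *m Q = observed_probabilities Pr A /\
    (forall j : 'I_#|column_label m v|, 0 <= Q j 0).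
Proof.
pose Y phi (t : T phi) := [ffun k => A k phi t] : prod_ord v.
have mY phi : powerset_measurable (Y phi).
  apply: (@powerset_measurable_dffun _ _ _ (fun k => 'I_(v k) : finType)) => k.
  exact: A_measurable.
split=> [[dO [W [mu [dS [S [X [f [mf YX]]]]]]]] |
    [Q [/(linear_systemP Pr A_measurable) YQ Q_ge0]]].
  (* The random column label: all potential outputs at once, for every input value, computed from
     the same value of [X]. Its law is the required solution. *)
  pose H w : column_label m v :=
    [ffun ki : {k : 'I_n & 'I_(m k)} => f (tag ki) (tagged ki) (X w)].
  have mH : powerset_measurable H.
    apply: (@powerset_measurable_dffun _ _ {k : 'I_n & 'I_(m k)}
      (fun ki => 'I_(v (tag ki)) : finType)) => ki B.
    have := measurable_funPT X measurableT _ (mf (tag ki) (tagged ki) B).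
    by rewrite setTI.
  pose Q : 'cV[R]_#|column_label m v| :=
    \col_j fine (mu (H @^-1` [set enum_val j])%classic).
  exists Q; split=> [|j]; last by rewrite mxE fine_ge0.
  apply/(linear_systemP Pr A_measurable) => a phi.
  rewrite YX -sumEFin.
  under eq_bigr do rewrite mxE fineK ?fin_num_measure//.
  transitivity (\sum_(h | treatment_outputs (val phi) h == a)
      mu (H @^-1` [set h])%classic)%E; last first.
    rewrite (reindex (fun j : 'I_#|column_label m v| => enum_val j))//.
    exact/onW_bij/enum_val_bij.
  transitivity (mu (H @^-1` [set h | treatment_outputs (val phi) h = a])%classic).
    congr (mu _); apply/seteqP.
    have HE w : treatment_outputs (val phi) (H w) =
        [ffun k => f k (val phi k) (X w)].
      by apply/ffunP => k; rewrite !ffunE /column_entry ffunE.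
    by split=> w /=; rewrite HE.
  rewrite probability_preimage_fin//; apply: eq_bigl => h.
  by apply/idP/eqP; rewrite inE.
have [phi0 phi0P] := set0Pn _ Phi_neq0.
(* A single allowable treatment suffices: the fibers of [treatment_outputs phi0] partition the
   columns, and their masses are the probabilities of the values of [Y phi]. *)
have Q_sum1 : \sum_j Q j 0 = 1.
  pose phi := Sub phi0 phi0P : allowable Phi.
  apply: EFin_inj; rewrite -(probability_setT (Pr phi)).
  rewrite -(preimage_setT (Y phi)) probability_preimage_fin//.
  rewrite (eq_bigr _ (fun a _ => YQ a phi)).
  rewrite sumEFin (partition_big
    (fun j => treatment_outputs phi0 (enum_val j)) predT)//=.
  by congr _%:E; apply: eq_bigl => a; rewrite in_setT.
have [mu muE] := finite_probability_nat Q_ge0 Q_sum1.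
(* Some column exists, as an empty sum could not be 1. It serves only as the label decoded from
   naturals beyond the last column, which have mass 0. *)
have j0 : 'I_#|column_label m v|.
  case: #|column_label m v| Q Q_sum1 {YQ Q_ge0 mu muE} => [Q|N _ _].
    by rewrite big_ord0 => /eqP; rewrite eq_sym oner_eq0.
  exact: ord0.
pose h (s : nat) := enum_val (odflt j0 (insub s)) : column_label m v.
(* R is the identity on [nat], a random column index; [f] decodes it and reads off one entry of the
   label. *)
exists _, nat, mu, _, nat.
have mid : measurable_fun setT (idfun : nat -> nat) by exact: measurable_id.
pose X : {RV mu >-> nat} := HB.pack (idfun : nat -> nat)
  (isMeasurableFun.Build _ _ _ _ (idfun : nat -> nat) mid).
exists X, (fun k l s => column_entry (h s) l); split=> // phi B.
rewrite !probability_preimage_fin//; apply: eq_bigr => a _.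
rewrite muE [LHS](YQ a phi); congr _%:E; apply: eq_bigl => j.
apply/eqP/idP; rewrite inE /= /h valK; exact.
Qed.
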